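(* Let $z=(z(n))_{n\in\mathbb{N}}\in(S^1\cup\{0\})^{\mathbb{N}}$ be a Chowla sequence. Then $z$ is orthogonal to every topological dynamical system of zero entropy: for every compact metric space $X$, every continuous map $T:X\to X$ with topological entropy $h(T)=0$, every continuous function $f:X\to\mathbb{C}$ and every $x\in X$, $$\lim_{N\to\infty}\frac1N\sum_{n=0}^{N-1} f(T^nx)\,z(n)=0.$$
   Context: $\mathbb{N}=\{0,1,2,\dots\}$, $\mathbb{N}_{\ge 2}=\mathbb{N}\setminus\{0,1\}$, and $S^1$ is the unit circle in $\mathbb{C}$. For $m\in\mathbb{N}_{\ge2}$ let $U(m)=\{e^{2\pi i k/m}:0\le k\le m-1\}$, and $U(\infty)=S^1$. The index of a sequence $z=(z(n))_{n\in\mathbb{N}}\in(S^1\cup\{0\})^{\mathbb{N}}$ is the smallest $m\in\mathbb{N}_{\ge2}\cup\{\infty\}$ such that $\{n\in\mathbb{N}: z(n)\notin U(m)\cup\{0\}\}$ has density zero in $\mathbb{N}$, i.e. $\frac1N\#\{0\le n\le N-1: z(n)\notin U(m)\cup\{0\}\}\to0$. For $x\in S^1\cup\{0\}$ and $n\in\mathbb{Z}$, put $x^{(n)}=x^n$ if $x\in S^1$ and $x^{(n)}=0$ if $x=0$; write $z^{(i)}(n)=(z(n))^{(i)}$. Let $I(m)=\{0,1,\dots,m-1\}$ if $m\in\mathbb{N}_{\ge2}$, and $I(\infty)=\mathbb{Z}$. A sequence $z\in(S^1\cup\{0\})^{\mathbb{N}}$ of index $m$ has the Chowla property (is a Chowla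 sequence) if $$\lim_{N\to\infty}\frac1N\sum_{n=0}^{N-1} z^{(i_1)}(n+a_1)\,z^{(i_2)}(n+a_2)\cdots z^{(i_r)}(n+a_r)=0$$ for every $r\ge1$, all integers $0\le a_1<\dots<a_r$ and all $i_1,\dots,i_r\in I(m)$ not all equal to $0$. *)

(* Defs.v *)
From HB Require Import structures.
From mathcomp Require Import all_boot all_order all_algebra finmap.
From mathcomp Require Import complex.
From mathcomp Require Import all_classical all_reals all_analysis.
Set Implicit Arguments. Unset Strict Implicit. Unset Printing Implicit Defensive.
Import Order.TTheory GRing.Theory Num.Theory.
Import numFieldNormedType.Exports.

Local Open Scope classical_set_scope.
Local Open Scope ring_scope.

(* The complex numbers as a field with its norm topology: the library equips
   the carrier of a [numFieldType] with this topology, but not the bare type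
   [R[i]]. *)
Definition cplx (R : realType) : numFieldType := R[i].

Section Sequences.
Variable R : realType.
Local Notation C := (cplx R).
Implicit Types (x : C) (z : nat -> C).

(* [Some m] stands for the natural number m and [None] for infinity. *)
Definition idx := option nat.

Definition idx_valid (m : idx) : bool :=
  if m is Some k then (2 <= k)%N else true.

Definition idx_le (m m' : idx) : bool :=
  match m, m' with
  | _, None => true
  | None, Some _ => false
  | Some k, Some k' => (k <= k')%N
  end.

Definition unit_circle : set C := [set x | `|x| = 1].

Definition cis (t : R) : C := Complex (cos t) (sin t).

Definition U_ (m : idx) : set C :=
  if m is Some m then [set cis (2 * pi * k%:R / m%:R) | k in [set k | (k < m)%N]]
  else unit_circle.

Definition density_zero (A : set nat) : Prop :=
  (\sum_(n < N) \1_A (n : nat)) / N%:R @[N --> \oo] --> (0 : R).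

Definition essentially_in_U z (m : idx) : Prop :=
  density_zero [set n | ~ (U_ m `|` [set 0]) (z n)].

Definition is_index z (m : idx) : Prop :=
  [/\ idx_valid m, essentially_in_U z m &
      forall m', idx_valid m' -> essentially_in_U z m' -> idx_le m m'].

(* This differs from [x ^ n] at x = 0, n = 0, where [x ^ n] is 1. *)
Definition ppow x (n : int) : C := if x == 0 then 0 else x ^ n.

Definition exponents (m : idx) : set int :=
  if m is Some k then [set i | 0 <= i < k%:Z] else setT.

Definition Chowla z : Prop :=
  exists2 m, is_index z m &
  forall (r : nat) (a : 'I_r -> nat) (i : 'I_r -> int),
    (1 <= r)%N ->
    (forall j k : 'I_r, (j < k)%N -> (a j < a k)%N) ->
    (forall j, exponents m (i j)) ->
    (exists j, i j != 0) ->
    (\sum_(n < N) \prod_(j < r) ppow (z (n + a j)%N) (i j)) / N%:R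
      @[N --> \oo] --> (0 : C).

End Sequences.

Section Entropy.
Variables (R : realType) (X : metricType R) (T : X -> X).

(* Open ball for the metric d_n(x, y) = max_(0 <= k < n) d(T^k x, T^k y). *)
Definition Bowen_ball (n : nat) (e : R) (x : X) : set X :=
  [set y | forall k, (k < n)%N -> mdist (iter k T x) (iter k T y) < e].

Definition spanning (n : nat) (e : R) (F : {fset X}) : Prop :=
  forall y, exists2 x, x \in F & Bowen_ball n e x y.

Definition spanning_number (n : nat) (e : R) : \bar R :=
  ereal_inf [set (#|` F|%:R)%:E | F in spanning n e].

(* Bowen's definition.  The inner limsup is nonincreasing in e, so the limit at
   0+ always exists in the extended reals. *)
Definition topological_entropy : \bar R :=
  lim (limn_esup (fun n => (n%:R^-1)%:E * lne (spanning_number n e))%E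
    @[e --> 0^'+]).

End Entropy.

(* Main.v *)
Require Import Defs.
From HB Require Import structures.
From mathcomp Require Import all_boot all_order all_algebra finmap.
From mathcomp Require Import complex.
From mathcomp Require Import all_classical all_reals all_analysis.
From mathcomp Require Import zify ring lra.
Import Order.TTheory GRing.Theory Num.Theory.
Import numFieldNormedType.Exports.
Local Open Scope classical_set_scope.
Local Open Scope ring_scope.

(* Fix a block length H and a number d > 0. A block sum
   sum_(h < H) w_h z(n+h) with |w_h| <= 1 of modulus at least 2 d H makes one of
   the four Riesz products prod_(h < H) (1 + (d/4) Re(i^k w_h z(n+h))) at least
   exp(d^2 H / 8). Expanding such a product gives 1 plus correlations of z with
   exponents 1 and -1 at distinct shifts, so by the Chowla property its average
   over n tends to 1: a given weight vector w correlates with z only on a set of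
   n of upper density at most 4 exp(-d^2 H / 8). Zero entropy provides a set of
   exp(o(H)) weight vectors approximating every orbit block (f(T^(n+h) x))_h, so
   the union bound makes most block sums small, and averaging over n finishes. *)

(** * The complex modulus as a real number *)

Section ComplexModulus.
Local Open Scope complex_scope.
Context {R : realType}.
Local Notation C := (cplx R).
Local Notation Re := (@complex.Re R).
Local Notation Im := (@complex.Im R).
Local Notation normc := (@ComplexField.Normc.normc R).
Implicit Types u v : C.

Lemma normrE_normc u : `|u| = (normc u)%:C.
Proof. by []. Qed.

Lemma normc_ge0 u : 0 <= normc u.
Proof. by case: u => a b; exact: sqrtr_ge0. Qed.

Lemma normcD_le u v : normc (u + v) <= normc u + normc v.
Proof. exact: le_normcD. Qed.

Lemma normc_opp u : normc (- u) = normc u.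
Proof. exact: normcN. Qed.

Lemma normc_mul u v : normc (u * v) = normc u * normc v.
Proof. exact: ComplexField.Normc.normcM. Qed.

Lemma normc_real (a : R) : normc a%:C = `|a|.
Proof. by rewrite /= expr0n addr0 sqrtr_sqr. Qed.

Lemma normc_conj u : normc u^* = normc u.
Proof. by case: u => a b /=; rewrite sqrrN. Qed.

Lemma normc_sum_le (I : Type) (r : seq I) (F : I -> C) :
  normc (\sum_(i <- r) F i) <= \sum_(i <- r) normc (F i).
Proof.
elim/big_rec2: _ => [|i a b _ ab]; first by rewrite ComplexField.Normc.normc0.
by apply: le_trans (normcD_le _ _) _; rewrite lerD2l.
Qed.

Lemma normc_le_ReIm u : normc u <= `|Re u| + `|Im u|.
Proof.
case: u => a b /=; rewrite -[leRHS]ger0_norm ?addr_ge0//.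
rewrite -sqrtr_sqr ler_wsqrtr// sqrrD !real_normK ?num_real//.
by rewrite -addrA lerD2l lerDr mulrn_wge0// mulr_ge0.
Qed.

Lemma Re_le_normc u : `|Re u| <= normc u.
Proof. by have := normc_ge_Re u; rewrite lecR. Qed.

End ComplexModulus.

(** * Lower bounds for real Riesz products *)

Lemma expR_quadratic_le (R : realType) (t : R) :
  - 2^-1 <= t -> expR (t - 2 * t ^+ 2) <= 1 + t.
Proof.
move=> t_ge; set y := t - 2 * t ^+ 2.
have t1 : 0 <= 1 + t by lra.
(* Since [expR (- y) >= 1 - y], it is enough that the polynomial [(1 + t) * (1 - y)] is at least 1;
   this is where [t >= -1/2] enters. *)
have step : 1 <= (1 + t) * expR (- y).
  apply: (@le_trans _ _ ((1 + t) * (1 - y))).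
    have -> : (1 + t) * (1 - y) = 1 + t ^+ 2 * (1 + 2 * t) by rewrite /y; ring.
    by rewrite lerDl mulr_ge0 ?sqr_ge0//; lra.
  by rewrite ler_wpM2l// expR_ge1Dx.
rewrite -[leLHS]mul1r -[1 + t]mulr1 -[X in _ <= _ * X](expRxMexpNx_1 y).
by rewrite [expR y * _]mulrC mulrA ler_wpM2r// expR_ge0.
Qed.

(** If the sum exceeds [d H], the product is at least exp(d^2 H/4 - d^2 H/8), so the second term
    alone beats the trivial bound [H]. The right side is affine in the product, so it can be
    averaged directly: Markov's inequality is built in. *)
Lemma sum_le_riesz (R : realType) (H : nat) (x : nat -> R) (d : R) :
  0 < d <= 1 -> (forall h, `|x h| <= 1) ->
  \sum_(h < H) x h <=
    H%:R * (d + expR (- (d ^+ 2 / 8 * H%:R)) * \prod_(h < H) (1 + d / 4 * x h)).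
Proof.
move=> /andP[d0 d1] x1.
(* This keeps every factor positive and within the range of [expR_quadratic_le]. *)
have bnd h : - (4^-1) <= d / 4 * x h.
  by have := x1 h; rewrite ler_norml => /andP[? ?]; nra.
set P := \prod_(h < H) _.
have P0 : 0 <= P by apply: prodr_ge0 => h _; have := bnd h; lra.
have [small|big] := leP (\sum_(h < H) x h) (H%:R * d).
  by rewrite (le_trans small)// ler_wpM2l// lerDl mulr_ge0// expR_ge0.
have sumH : \sum_(h < H) x h <= H%:R.
  rewrite -[H in leRHS]card_ord -sum1_card natr_sum.
  by apply: ler_sum => h _; have := x1 h; rewrite ler_norml => /andP[].
have P_ge : expR (d ^+ 2 / 8 * H%:R) <= P.
  apply: (@le_trans _ _ (\prod_(h < H) expR (d / 4 * x h - d ^+ 2 / 8))).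
    rewrite -expR_sum ler_expR sumrB -mulr_sumr sumr_const card_ord.
    by rewrite -mulr_natr; nra.
  apply: ler_prod => h _; rewrite expR_ge0/=.
  have /expR_quadratic_le : - 2^-1 <= d / 4 * x h by have := bnd h; lra.
  apply: le_trans.
  rewrite ler_expR lerB// exprMn.
  have : x h ^+ 2 <= 1.
    by have := x1 h; rewrite ler_norml => /andP[? ?]; nra.
  by have := sqr_ge0 d; nra.
rewrite (le_trans sumH)// -{1}[H%:R]mulr1 ler_wpM2l//.
apply: (@le_trans _ _ (expR (- (d ^+ 2 / 8 * H%:R)) * P)).
  rewrite -[leLHS](expRxMexpNx_1 (d ^+ 2 / 8 * H%:R)) [leLHS]mulrC.
  by rewrite ler_wpM2l// expR_ge0.
by rewrite lerDr ltW.
Qed.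

(** * Riesz products with complex entries *)

Section RieszProduct.
Local Open Scope complex_scope.
Context {R : realType}.
Local Notation C := (cplx R).
Local Notation Re := (@complex.Re R).
Local Notation Im := (@complex.Im R).
Local Notation normc := (@ComplexField.Normc.normc R).

Definition riesz (H : nat) (d : R) (u : nat -> C) : R :=
  \prod_(h < H) (1 + d / 4 * Re (u h)).

Lemma riesz_ge0 (H : nat) (d : R) (u : nat -> C) :
  0 < d <= 1 -> (forall h, normc (u h) <= 1) -> 0 <= riesz H d u.
Proof.
move=> /andP[d0 d1] u1; apply: prodr_ge0 => h _.
have := le_trans (Re_le_normc (u h)) (u1 h).
by rewrite ler_norml => /andP[? ?]; nra.
Qed.

(* The four rotations by powers of i control the positive and negative parts of
   the real and imaginary parts of the sum. *)
Lemma normc_sum_le_riesz (H : nat) (d : R) (u : nat -> C) :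
  0 < d <= 1 -> (forall h, normc (u h) <= 1) ->
  normc (\sum_(h < H) u h) <=
    H%:R * (2 * d + expR (- (d ^+ 2 / 8 * H%:R)) *
      \sum_(k < 4) riesz H d (fun h => 'i ^+ k * u h)).
Proof.
move=> d01 u1; set E := expR _.
have normi k : normc ('i ^+ k) = 1.
  elim: k => [|k IH]; first by rewrite expr0 ComplexField.Normc.normc1.
  by rewrite exprS normc_mul IH mulr1 /= expr0n expr1n add0r sqrtr1.
have iu1 k h : normc ('i ^+ k * u h) <= 1.
  by rewrite normc_mul normi mul1r.
pose r k := riesz H d (fun h => 'i ^+ k * u h).
have r0 k : 0 <= E * r k by rewrite mulr_ge0 ?expR_ge0// riesz_ge0.
have bnd k : Re ('i ^+ k * \sum_(h < H) u h) <= H%:R * (d + E * r k).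
  rewrite mulr_sumr raddf_sum.
  apply: (@sum_le_riesz R H (fun h => Re ('i ^+ k * u h)) d d01) => h.
  exact: le_trans (Re_le_normc _) (iu1 k h).
set S := \sum_(h < H) u h in bnd *.
have := bnd 0%N; have := bnd 1%N; have := bnd 2%N; have := bnd 3%N.
(* For k = 0, 1, 2, 3 the bounds concern Re S, -Im S, -Re S and Im S. Two of them bound |Re S| + |Im
   S|, whence [2 * d]; the other two products are nonnegative and may be added. *)
have -> : 'i ^+ 3 * S = - ('i * S) by rewrite exprS sqr_i mulrN1 mulNr.
rewrite sqr_i mulN1r expr1 expr0 mul1r mulrC.
rewrite !raddfN/= ReiNIm => b3 b2 b1 b0.
have -> : \sum_(k < 4) riesz H d (fun h => 'i ^+ k * u h) = r 0%N + r 1%N + r 2%N + r 3%N.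
  by rewrite !big_ord_recr big_ord0 /= add0r.
apply: le_trans (normc_le_ReIm _) _.
have pos k : 0 <= H%:R * (E * r k) by rewrite mulr_ge0.
have := pos 0%N; have := pos 1%N; have := pos 2%N; have := pos 3%N.
have : 0 <= H%:R * d by rewrite mulr_ge0//; case/andP: d01 => /ltW.
move: b0 b1 b2 b3; rewrite !mulrDr.
by case: (ger0P (Re S)) => ?; case: (ger0P (Im S)) => ?; lra.
Qed.
End RieszProduct.

(** * Correlations of a Chowla sequence and its conjugate *)

Section Correlations.
Local Open Scope complex_scope.
Context {R : realType}.
Local Notation C := (cplx R).
Local Notation normc := (@ComplexField.Normc.normc R).

Lemma cisD (a b : R) : cis (a + b) = cis a * cis b.
Proof. by rewrite /cis cosD sinD; congr Complex; rewrite addrC. Qed.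

Lemma cisX (a : R) (n : nat) : cis a ^+ n = cis (a * n%:R).
Proof.
elim: n => [|n IH]; first by rewrite expr0 mulr0 /cis cos0 sin0.
by rewrite exprS IH -cisD -natr1 mulrDr mulr1 addrC.
Qed.

Lemma U_Some_expr (m : nat) (x : C) : (0 < m)%N -> U_ (Some m) x -> x ^+ m = 1.
Proof.
move=> m0 [k _ <-]; rewrite cisX.
have -> : 2 * pi * k%:R / m%:R * m%:R = (pi *+ 2 * k%:R : R).
  by rewrite divfK ?pnatr_eq0 -?lt0n// mulr_natl.
by rewrite -cisX {1}/cis cos2pi sin2pi expr1n.
Qed.

Lemma conjc_circle (x : C) : unit_circle x -> x^* = x^-1.
Proof. by move=> x1; rewrite invc_norm x1 expr1n invr1 mul1r. Qed.

Definition conj_if (b : bool) (x : C) : C := if b then x^* else x.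

Lemma normc_conj_if b (x : C) : normc (conj_if b x) = normc x.
Proof. by case: b => //=; exact: normc_conj. Qed.

(* In U(m), complex conjugation is the power m - 1, an admissible exponent. *)
Lemma conj_if_ppow (m : idx) : idx_valid m -> exists e : bool -> int,
  forall b, [/\ exponents m (e b), e b != 0 & forall x : C,
    (@unit_circle R `|` [set 0]) x -> (U_ m `|` [set 0]) x ->
    ppow x (e b) = conj_if b x].
Proof.
have ne0 (x : C) : unit_circle x -> x != 0.
  by move=> x1; rewrite -normr_eq0 x1 oner_eq0.
have ppow1 (x : C) : ppow x 1 = x by rewrite /ppow expr1z; case: eqP => // ->.
case: m => [m /= m2|_]; last first.
  exists (fun b => if b then -1 else 1) => -[]; split => //.
  move=> x [x1|->] _; last by rewrite /ppow eqxx /conj_if conjc0.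
  by rewrite /ppow (negbTE (ne0 _ x1)) exprN1 /= conjc_circle.
exists (fun b => if b then m.-1%:Z else 1) => -[]; split => [||x].
- by rewrite /=; lia.
- by lia.
- case=> [x1 [Um|x0]|->]; last 2 first.
  + by move: (ne0 _ x1); rewrite x0 eqxx.
  + by rewrite /ppow eqxx /conj_if conjc0.
  rewrite /ppow (negbTE (ne0 _ x1)) /= conjc_circle//.
  apply: (mulIf (ne0 _ x1)); rewrite mulVf ?ne0// -exprSr prednK ?(ltnW m2)//.
  by apply: U_Some_expr => //; exact: ltnW.
- by rewrite /=; lia.
- by [].
- by move=> _ _; exact: ppow1.
Qed.

Lemma cvg_divn (c : R) : c / N%:R @[N --> \oo] --> 0.
Proof.
rewrite -[0](mulr0 c); apply: cvgMl_tmp.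
apply/gtr0_cvgV0; last exact: cvgr_idn.
by exists 1%N => // n /= n0; rewrite ltr0n.
Qed.

Lemma cvg_normc_le (u v : nat -> C) (r : nat -> R) (l : C) :
  (forall n, normc (u n - v n) <= r n) -> r n @[n --> \oo] --> 0 ->
  v n @[n --> \oo] --> l -> u n @[n --> \oo] --> l.
Proof.
move=> uvr r0 vl; apply/cvgrPdist_lt => e.
(* In the order on complex numbers, [0 < e] forces the imaginary part to vanish. *)
case: e => e e' e0; have [e'0 {}e0] : e' = 0 /\ 0 < e.
  by move: e0; rewrite ltcE /= => /andP[/eqP ->].
have e20 : 0 < e / 2 by rewrite divr_gt0.
have e20C : 0 < ((e / 2)%:C : C) by rewrite ltcR.
near=> n.
have rn : `|r n| < e / 2 by near: n; exact: cvgr0_norm_lt.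
have vn : `|l - v n| < ((e / 2)%:C : C) by near: n; apply: (cvgrPdist_lt _ _).1.
rewrite e'0 normrE_normc ltcR.
have -> : l - u n = (l - v n) - (u n - v n) by rewrite opprB addrA subrK.
apply: le_lt_trans (normcD_le _ _) _; rewrite normc_opp [e]splitr ltrD//.
  by move: vn; rewrite normrE_normc ltcR.
by apply: le_lt_trans (uvr n) (le_lt_trans (ler_norm _) rn).
Unshelve. all: by end_near. Qed.

(** Each unit shift of the window drops a nonnegative term and gains a term at most 1. *)
Lemma sum_shift_le (x : nat -> R) (a N : nat) : (forall n, 0 <= x n <= 1) ->
  \sum_(n < N) x (n + a)%N <= \sum_(n < N) x n + a%:R.
Proof.
move=> x01; elim: a => [|a IH].
  by rewrite addr0; apply: ler_sum => n _; rewrite addn0.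
rewrite -natr1 addrA; apply: le_trans _ (lerD IH (lexx 1)).
have : \sum_(n < N.+1) x (n + a)%N = \sum_(n < N) x (n + a)%N + x (N + a)%N.
  by rewrite big_ord_recr.
rewrite big_ord_recl/= add0n.
under eq_bigr do rewrite /bump /= add1n addSnnS.
move=> sumE; have /andP[xa0 _] := x01 a; have /andP[_ xN1] := x01 (N + a)%N.
by lra.
Qed.

Context (z : nat -> C).
Hypothesis hz : forall n, (@unit_circle R `|` [set 0]) (z n).

Lemma normc_z_le1 n : normc (z n) <= 1.
Proof.
case: (hz n) => [z1|->]; last by rewrite ComplexField.Normc.normc0.
by have : `|z n| = 1 by []; rewrite normrE_normc => -[->].
Qed.

Lemma normc_ppow_le1 n (i : int) : normc (ppow (z n) i) <= 1.
Proof.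
rewrite -lecR -normrE_normc /ppow; case: eqVneq => [|zn0]; first by rewrite normr0 ler01.
case: (hz n) => [z1|z0]; last by rewrite z0 eqxx in zn0.
by case: i => i; rewrite ?NegzE -?exprnN -?exprnP ?normfV normrX z1 expr1n ?invr1.
Qed.

(* In a pair (a, b), a is the shift and b tells whether to conjugate. *)
Let corr (s : seq (nat * bool)) (n : nat) : C :=
  \prod_(p <- s) conj_if p.2 (z (n + p.1)%N).

Lemma normc_prod_le1 (I : Type) (s : seq I) (F : I -> C) :
  (forall i, normc (F i) <= 1) -> normc (\prod_(i <- s) F i) <= 1.
Proof.
move=> F1; elim/big_rec: _ => [|i x _ x1].
  by rewrite ComplexField.Normc.normc1.
by rewrite normc_mul mulr_ile1 ?normc_ge0.
Qed.

(** Where [z] takes values in U(m) or 0, conjugates are admissible powers and the Chowla property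
    applies; the remaining indices have density zero, also after finitely many shifts. *)
Lemma Chowla_conj (s : seq (nat * bool)) : Chowla z -> s != [::] ->
  sorted ltn [seq p.1 | p <- s] ->
  (\sum_(n < N) corr s n) / N%:R @[N --> \oo] --> (0 : C).
Proof.
move=> [m [m_valid ess_U _] chowla] s0 s_sorted.
have [e eP] := conj_if_ppow _ m_valid.
pose pcorr n := \prod_(p <- s) ppow (z (n + p.1)%N) (e p.2).
have pcorr0 : (\sum_(n < N) pcorr n) / N%:R @[N --> \oo] --> (0 : C).
  pose d0 := (0%N, false).
  have corrE N : \sum_(n < N) \prod_(j < size s)
      ppow (z (n + (nth d0 s j).1)%N) (e (nth d0 s j).2) = \sum_(n < N) pcorr n.
    by apply: eq_bigr => n _; rewrite /pcorr (big_nth d0) big_mkord.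
  rewrite (_ : (fun N : nat => _) = fun N : nat => (\sum_(n < N) \prod_(j < size s)
      ppow (z (n + (nth d0 s j).1)%N) (e (nth d0 s j).2)) / N%:R); last first.
    by apply/funext => N; rewrite corrE.
  apply: (chowla (size s) (fun j => (nth d0 s j).1) (fun j => e (nth d0 s j).2)).
  - by rewrite lt0n size_eq0.
  - move=> j k jk; rewrite -!(nth_map d0 0%N fst)//.
    by apply: (@sorted_ltn_nth nat ltn ltn_trans 0%N _ s_sorted) => //; rewrite inE size_map.
  - by move=> j; have [] := eP (nth d0 s j).2.
  - have s_gt0 : (0 < size s)%N by rewrite lt0n size_eq0.
    by exists (Ordinal s_gt0); have [] := eP (nth d0 s (Ordinal s_gt0)).2.
pose B := [set n | ~ (U_ m `|` [set 0]) (z n)].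
pose bad n : R := \1_B n.
have bad01 n : 0 <= bad n <= 1.
  by rewrite /bad indicE; case: (n \in B); rewrite /= lexx ler01.
(* The products agree unless some shifted index is bad; otherwise both have modulus at most 1, so
   they differ by at most 2. *)
have diff n : normc (corr s n - pcorr n) <= 2 * \sum_(p <- s) bad (n + p.1)%N.
  have [good|] := boolP (all (fun p => (n + p.1)%N \notin B) s).
    rewrite (_ : corr s n = pcorr n) ?subrr ?ComplexField.Normc.normc0.
      by rewrite mulr_ge0// sumr_ge0// => p _; case/andP: (bad01 (n + p.1)%N).
    apply: eq_big_seq => p ps; have [_ _ ->] := eP p.2; rewrite //.
    by have := allP good p ps; rewrite notin_setE /B /= => /contrapT.
  rewrite -has_predC => /hasP[p ps /=]; rewrite negbK => pB.
  have big1' : 1 <= \sum_(q <- s) bad (n + q.1)%N.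
    by rewrite (big_rem p)//= {1}/bad indicE pB lerDl sumr_ge0.
  apply: (@le_trans _ _ 2); last by rewrite ler_pMr.
  apply: le_trans (normcD_le _ _) _; rewrite normc_opp.
  rewrite (_ : 2 = 1 + 1 :> R)// lerD//; apply: normc_prod_le1 => q.
    by rewrite normc_conj_if normc_z_le1.
  exact: normc_ppow_le1.
apply: (@cvg_normc_le _ (fun N => (\sum_(n < N) pcorr n) / N%:R)
  (fun N => 2 * ((size s)%:R * ((\sum_(n < N) bad n) / N%:R)
                 + (\sum_(p <- s) p.1%:R) / N%:R))) => //.
  move=> N; rewrite -mulrBl -sumrB normc_mul.
  have -> : normc (N%:R^-1 : C) = N%:R^-1.
    by rewrite -[N%:R](rmorph_nat (real_complex R)) -fmorphV normc_real ger0_norm.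
  rewrite mulrA -mulrDl mulrA ler_wpM2r//.
  apply: le_trans (normc_sum_le _ _ _) _.
  apply: (@le_trans _ _ (\sum_(n < N) 2 * \sum_(p <- s) bad (n + p.1)%N)).
    by apply: ler_sum => n _; exact: diff.
  rewrite -mulr_sumr ler_wpM2l// exchange_big/=.
  rewrite -sum1_size natr_sum mulr_suml -big_split/=.
  by apply: ler_sum => p _; rewrite mul1r; exact: sum_shift_le.
rewrite [X in _ --> X](_ : 0 = 2 * ((size s)%:R * 0 + 0)); last first.
  by rewrite !(mulr0, addr0).
apply: cvgMl_tmp; apply: cvgD; last exact: cvg_divn.
by apply: cvgMl_tmp; exact: ess_U.
Qed.

(* Peeling off the last factor of the product splits each average into three
   averages of the same kind, so everything reduces to correlations. *)
Lemma Chowla_prod (a b : nat -> C) (k : nat) (s : seq (nat * bool)) : Chowla z ->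
  sorted ltn [seq p.1 | p <- s] -> all (leq k) [seq p.1 | p <- s] ->
  (\sum_(n < N) (\prod_(h < k) (1 + a h * z (n + h)%N + b h * (z (n + h)%N)^*)) *
     corr s n) / N%:R
    @[N --> \oo] --> ((s == [::])%:R : C).
Proof.
move=> hC; elim: k s => [|k IH] s s_sorted s_ge.
  under eq_fun do under eq_bigr do rewrite big_ord0 mul1r.
  case: eqP => [->|/eqP s0]; last exact: Chowla_conj.
  apply: cvg_near_cst; exists 1%N => // N /= N0.
  under eq_bigr do rewrite /corr big_nil.
  by rewrite sumr_const card_ord divff// pnatr_eq0 -lt0n.
have s_ge' : all (leq k) [seq p.1 | p <- s].
  by apply: sub_all s_ge => j; exact: ltnW.
(* All shifts in [s] exceed [k], so the peeled factor can be put in front of [s]. The two enlarged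
   lists are nonempty and give limit 0; only the term 1 of the factor keeps [s]. *)
have sortedk c : sorted ltn [seq p.1 | p <- (k, c) :: s].
  by rewrite /= path_sortedE ?s_ge//; exact: ltn_trans.
have gek c : all (leq k) [seq p.1 | p <- (k, c) :: s] by rewrite /= leqnn.
rewrite [X in _ --> X](_ : _ = (s == [::])%:R + a k * 0 + b k * 0); last first.
  by rewrite !(mulr0, addr0).
have lim0 := IH s s_sorted s_ge'.
have limz := cvgMl_tmp (a := a k) (IH _ (sortedk false) (gek false)).
have limc := cvgMl_tmp (a := b k) (IH _ (sortedk true) (gek true)).
have lim1 := cvgD (cvgD lim0 (limz _)) (limc _).
apply: cvg_trans (lim1 _ _ _ _); apply: near_eq_cvg; near=> N.
rewrite !fctE !mulrA -!mulrDl; congr (_ * _).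
rewrite !mulr_sumr -!big_split/=; apply: eq_bigr => n _.
by rewrite big_ord_recr/= {2 3}/corr !big_cons -/(corr s n) /=; ring.
Unshelve. all: by end_near. Qed.

End Correlations.

(** * Small spanning sets from zero entropy *)

Section ZeroEntropy.
Context {R : realType} {X : metricType R} (T : X -> X).

Lemma spanning_le (n : nat) (e e' : R) (F : {fset X}) :
  e <= e' -> spanning T n e F -> spanning T n e' F.
Proof.
move=> ee' spF y; have [p pF pB] := spF y; exists p => // k kn.
exact: lt_le_trans (pB k kn) ee'.
Qed.

Let growth (e : R) : \bar R :=
  limn_esup (fun n => (n%:R^-1)%:E * lne (spanning_number T n e))%E.

Lemma spanning_number_ge0 n e : (0 <= spanning_number T n e)%E.
Proof. by apply: le_ereal_inf_tmp => _ [F _ <-]; rewrite lee_fin. Qed.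

Lemma growth_nonincreasing :
  {in `]0%R, +oo[ &, nonincreasing_fun growth}.
Proof.
move=> e e' _ _ ee'; rewrite /growth.
apply: le_ereal_inf_tmp => _ [A FA <-].
apply: (@le_trans _ _ (ereal_sup ((fun n => (n%:R^-1)%:E * lne (spanning_number T n e'))%E @` A))).
  by apply: ereal_inf_lbound; exists A.
apply: ge_ereal_sup => _ [n An <-].
apply: (@le_trans _ _ ((n%:R^-1)%:E * lne (spanning_number T n e))%E); last first.
  by apply: ereal_sup_ubound; exists n.
apply: lee_wpmul2l; first by rewrite lee_fin.
rewrite lee_lne ?in_itv/= ?spanning_number_ge0 ?leey//.
apply: le_ereal_inf_tmp => _ [F spF <-].
by apply: ereal_inf_lbound; exists F => //; exact: spanning_le spF.
Qed.

(** By monotonicity in [e], the limit at 0+ is the supremum over all positive scales. *)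
Lemma growth_le_entropy (e : R) : 0 < e -> (growth e <= topological_entropy T)%E.
Proof.
move=> e0.
have -> : topological_entropy T = ereal_sup (growth @` [set` `]0%R, +oo[]).
  apply/cvg_lim => //.
  exact: (@nonincreasing_at_right_cvge _ growth 0 +oo%O isT growth_nonincreasing).
by apply: ereal_sup_ubound; exists e => //=; rewrite in_itv/= e0.
Qed.

Lemma entropy0_spanning (e eta : R) :
  topological_entropy T = 0%E -> 0 < e -> 0 < eta ->
  \forall n \near \oo, exists2 F : {fset X}, spanning T n e F &
    (#|` F|%:R : R) <= expR (eta * n%:R).
Proof.
move=> hT e0 eta0; have := growth_le_entropy e e0; rewrite hT => h0.
(* The limsup is an infimum of suprema over neighbourhoods [A] of infinity; one of these suprema is
   already below [eta]. *)
have /ereal_inf_lt[_ [A FA <-] supA] : (growth e < eta%:E)%E.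
  by rewrite (le_lt_trans h0)// lte_fin.
near=> n.
have n0 : (0 < n)%N by near: n; exact: nbhs_infty_gt.
have An : A n by near: n.
have : ((n%:R^-1)%:E * lne (spanning_number T n e) < eta%:E)%E.
  by apply: le_lt_trans supA; apply: ereal_sup_ubound; exists n.
rewrite lte_pdivrMl ?ltr0n// -EFinM mulrC.
rewrite -[X in (_ < X)%E]expeRK lte_lne ?in_itv/= ?spanning_number_ge0 ?leey//; last first.
  by rewrite lee_fin expR_ge0.
(* The strict bound on the infimum yields an actual spanning set, whether or not the infimum is
   attained. *)
move=> /ereal_inf_lt[_ [F spF <-]]; rewrite lte_fin => /ltW Fn.
by exists F.
Unshelve. all: by end_near. Qed.
End ZeroEntropy.

(** * Boundedness and uniform continuity on a compact space *)

Section CompactDomain.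
Local Open Scope complex_scope.
Context {R : realType} {X : metricType R}.
Hypothesis X_compact : compact [set: X].
Local Notation normc := (@ComplexField.Normc.normc R).
Implicit Type f : X -> cplx R.

Lemma continuous_normc f (x : X) (e : R) : continuous f -> 0 < e ->
  \forall y \near x, normc (f x - f y) < e.
Proof.
move=> fc e0; have e0C : 0 < (e%:C : cplx R) by rewrite ltcR.
have /cvgrPdist_lt /(_ _ e0C) := fc x; apply: filterS => y.
by rewrite ltcR.
Qed.

Lemma continuous_compact_normc_bounded f : continuous f ->
  exists2 M : R, 0 < M & forall x, normc (f x) <= M.
Proof.
move=> fc.
have : \forall M \near +oo, [set: X] `<=` (fun x => normc (f x) <= M).
  apply: (compact_near_coveringP _).1 => // x _.
  exists ([set y | normc (f x - f y) < 1], [set M | normc (f x) + 1 <= M]) => /=.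
    by split; [exact: continuous_normc|exact: nbhs_pinfty_ge (num_real _)].
  move=> [y M] [/= fxy leM].
  have -> : f y = f x - (f x - f y) by rewrite opprB addrC subrK.
  apply: le_trans (normcD_le _ _) (le_trans _ leM).
  by rewrite normc_opp lerD2l ltW.
move=> [M [_ MP]]; exists (Num.max M 0 + 1) => [|x]; first by rewrite ltr_wpDl// le_max lexx orbT.
by apply: MP => //; rewrite ltr_pwDr// le_max lexx.
Qed.

(** Heine-Cantor through near coverings: if [f] varies by less than e/2 on the [r]-ball at [x], then
    every [y] within r/2 of [x] admits all [d <= r / 2], by the triangle inequality. *)
Lemma continuous_compact_uniform f (e : R) : continuous f -> 0 < e ->
  exists2 d : R, 0 < d & forall x y, mdist x y < d -> normc (f x - f y) <= e.
Proof.
move=> fc e0.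
have : \forall d \near 0^'+, [set: X] `<=`
    (fun x => forall y, mdist x y < d -> normc (f x - f y) <= e).
  apply: (compact_near_coveringP _).1 => // x _.
  have /metricType_numDomainType.nbhs_mdistP[r /= r0 rP] :
    \forall y \near x, normc (f x - f y) < e / 2.
    by apply: continuous_normc => //; rewrite divr_gt0.
  have r2 : 0 < r / 2 by rewrite divr_gt0.
  exists ([set y | mdist x y < r / 2], [set d | d <= r / 2]) => /=.
    split; last exact: nbhs_right_le.
    by apply/metricType_numDomainType.nbhs_mdistP; exists (r / 2).
  move=> [y d] [/= xy dr] w yw.
  have xw : mdist x w < r.
    by rewrite (le_lt_trans (metric_triangle x y w))// [r]splitr ltrD// (lt_le_trans yw).
  have -> : f y - f w = (f x - f w) - (f x - f y) by rewrite opprB [RHS]addrC addrA subrK.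
  apply: le_trans (normcD_le _ _) _.
  rewrite normc_opp [e]splitr lerD// ltW// rP//=.
  by rewrite (lt_trans xy)// ltr_pdivrMr// ltr_pMr// ltr1n.
move=> [d /= d0 dP]; exists (d / 2) => [|x y]; first by rewrite divr_gt0.
apply: dP => //=; last by rewrite divr_gt0.
rewrite sub0r normrN gtr0_norm ?divr_gt0//.
by rewrite ltr_pdivrMr// ltr_pMr// ltr1n.
Qed.
End CompactDomain.

(** * Averages of Riesz products and of blocks *)

Section Averages.
Local Open Scope complex_scope.
Context {R : realType}.
Local Notation C := (cplx R).
Local Notation Re := (@complex.Re R).
Local Notation normc := (@ComplexField.Normc.normc R).

(** Writing Re w as half of w plus its conjugate turns d/4 into d/8 and gives the products of
    [Chowla_prod] with empty [s]. Their averages tend to 1, hence are eventually at most 2. *)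
Lemma riesz_mean (z : nat -> C) (H : nat) (d : R) (c : nat -> C) :
  (forall n, (@unit_circle R `|` [set 0]) (z n)) -> Chowla z ->
  \forall N \near \oo,
    \sum_(n < N) riesz H d (fun h => c h * z (n + h)%N) <= 2 * N%:R.
Proof.
move=> hz hC.
have := Chowla_prod z hz (fun h => (d / 8)%:C * c h) (fun h => (d / 8)%:C * (c h)^*)
  H [::] hC isT isT.
move=> /cvgrPdist_lt /(_ 1 ltr01) near1; near=> N.
have N0 : (0 < N%:R :> R) by rewrite ltr0n; near: N; exact: nbhs_infty_gt.
set S := \sum_(n < N) _.
have SE : S%:C = \sum_(n < N) (\prod_(h < H) (1 + (d / 8)%:C * c h * z (n + h)%N
    + (d / 8)%:C * (c h)^* * (z (n + h)%N)^*) *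
    \prod_(p <- [::]) conj_if p.2 (z (n + p.1)%N)).
  rewrite /S rmorph_sum/=; apply: eq_bigr => n _.
  rewrite big_nil mulr1 /riesz rmorph_prod/=; apply: eq_bigr => h _.
  rewrite rmorphD rmorph1 rmorphM/= -addrA; congr (_ + _).
  have -> : (d / 4)%:C = (d / 8)%:C * 2 :> C.
    by rewrite -(rmorph_nat (real_complex R)) -rmorphM; congr (_%:C); field.
  rewrite ReJ_add (rmorphM (@conjc R)); set e := (d / 8)%:C.
  by rewrite -[e * 2 * _]mulrA [2 * _]mulrC divfK ?pnatr_eq0//; ring.
have : `|1 - S%:C / N%:R| < (1 : C) by rewrite SE; near: N.
rewrite -[N%:R](rmorph_nat (real_complex R)) -fmorphV -rmorphM/=.
rewrite -[1 in X in `|X - _|](rmorph1 (real_complex R)) -rmorphB/=.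
rewrite normrE_normc normc_real -[ltRHS](rmorph1 (real_complex R)) ltcR.
rewrite ltr_norml => /andP[S_lt _].
have : S / N%:R <= 2 by lra.
by rewrite ler_pdivrMr.
Unshelve. all: by end_near. Qed.

Lemma near_sum_le (I : Type) (s : seq I) (a : I -> nat -> R) (c : R) :
  (forall i, \forall N \near \oo, a i N <= c * N%:R) ->
  \forall N \near \oo, \sum_(i <- s) a i N <= (size s)%:R * c * N%:R.
Proof.
move=> aP; elim: s => [|i s IH].
  by near=> N; rewrite big_nil !mul0r.
near=> N; rewrite big_cons /= -natr1 !mulrDl mul1r addrC lerD//.
  by near: N.
by near: N; exact: aP.
Unshelve. all: by end_near. Qed.

(** Each unit shift exchanges one term for another, at a cost of at most [2 * M]. *)
Lemma normc_sum_shift_le (g : nat -> C) (M : R) (h N : nat) :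
  (forall n, normc (g n) <= M) ->
  normc (\sum_(n < N) g n - \sum_(n < N) g (n + h)%N) <= 2 * M * h%:R.
Proof.
move=> gM; elim: h => [|h IH].
  under [X in _ - X]eq_bigr do rewrite addn0.
  by rewrite subrr ComplexField.Normc.normc0 mulr0.
have sumE : \sum_(n < N) g (n + h.+1)%N = \sum_(n < N) g (n + h)%N + g (N + h)%N - g h.
  have : \sum_(n < N.+1) g (n + h)%N = \sum_(n < N) g (n + h)%N + g (N + h)%N.
    by rewrite big_ord_recr.
  rewrite big_ord_recl/= add0n => <-; rewrite addrC addKr.
  by apply: eq_bigr => n _; rewrite /bump /= add1n addSnnS.
rewrite sumE; set S := \sum_(n < N) g n in IH *; set S' := \sum_(n < N) _ in IH *.
have -> : S - (S' + g (N + h)%N - g h) = (S - S') + (g h - g (N + h)%N).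
  by ring.
apply: le_trans (normcD_le _ _) _; rewrite -[h.+1%:R]natr1 mulrDr mulr1 lerD//.
apply: le_trans (normcD_le _ _) _; rewrite normc_opp.
by have := gM h; have := gM (N + h)%N; lra.
Qed.

(** Summing the shifted copies of the sum over h < H groups the terms into blocks; each copy is off
    by at most [2 * M * H]. *)
Lemma normc_sum_blocks (g : nat -> C) (M : R) (H N : nat) :
  (forall n, normc (g n) <= M) ->
  H%:R * normc (\sum_(n < N) g n) <=
    \sum_(n < N) normc (\sum_(h < H) g (n + h)%N) + 2 * M * H%:R ^+ 2.
Proof.
move=> gM; have M0 : 0 <= M := le_trans (normc_ge0 _) (gM 0%N).
set S := \sum_(n < N) g n.
have SE : H%:R * S = \sum_(n < N) \sum_(h < H) g (n + h)%N
    + \sum_(h < H) (S - \sum_(n < N) g (n + h)%N).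
  rewrite sumrB sumr_const card_ord exchange_big/= addrC subrK.
  by rewrite mulr_natl.
have -> : H%:R * normc S = normc (H%:R * S).
  by rewrite normc_mul -[H%:R in RHS](rmorph_nat (real_complex R)) normc_real ger0_norm.
rewrite SE; apply: le_trans (normcD_le _ _) _; apply: lerD.
  exact: normc_sum_le.
apply: le_trans (normc_sum_le _ _ _) _.
apply: (@le_trans _ _ (\sum_(h < H) 2 * M * H%:R)).
  apply: ler_sum => h _; apply: le_trans (normc_sum_shift_le _ _ _ _ gM) _.
  by rewrite ler_wpM2l ?mulr_ge0// ler_nat ltnW.
by rewrite sumr_const card_ord -[leLHS]mulr_natr -mulrA expr2.
Qed.

End Averages.

(** * Orthogonality to zero-entropy systems *)

Section Main.
Local Open Scope complex_scope.
Context {R : realType}.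
Local Notation C := (cplx R).
Local Notation normc := (@ComplexField.Normc.normc R).
Variables (z : nat -> C).
Hypothesis hz : forall n, (@unit_circle R `|` [set 0]) (z n).
Hypothesis z_Chowla : Chowla z.
Variables (X : metricType R) (T : X -> X) (f : X -> C).
Implicit Types (x p : X) (F : {fset X}).

(** Dividing by a bound [M] of [f] puts the weights in the unit disc. They depend on [p] but not on
    [n], as [riesz_mean] requires. *)
Let u (M : R) p (k n h : nat) : C := ('i ^+ k * ((M^-1)%:C * f (iter h T p))) * z (n + h)%N.

(* Replace the orbit of T^n x by that of a point of F shadowing it. *)
Lemma block_le (M d e r : R) F (H : nat) x (n : nat) :
  0 < M -> (forall x, normc (f x) <= M) -> 0 < d <= 1 ->
  (forall x y, mdist x y < r -> normc (f x - f y) <= e) -> spanning T H r F ->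
  normc (\sum_(h < H) f (iter (n + h) T x) * z (n + h)%N) <=
    H%:R * (e + M * (2 * d + expR (- (d ^+ 2 / 8 * H%:R)) *
      \sum_(p <- F) \sum_(k < 4) riesz H d (u M p k n))).
Proof.
move=> M0 fM d01 fr spF; have [p pF pB] := spF (iter n T x).
set E := expR _.
have u1 k q h : normc (u M q k n h) <= 1.
  rewrite normc_mul -[1]mulr1 ler_pM ?normc_ge0 ?normc_z_le1//.
  rewrite normc_mul -[1]mulr1 ler_pM ?normc_ge0//.
    rewrite -lecR -normrE_normc normrX (_ : `|'i : C| = 1) ?expr1n//.
    by rewrite normrE_normc /= expr0n expr1n add0r sqrtr1.
  rewrite normc_mul normc_real gtr0_norm ?invr_gt0// ler_pdivrMl// mulr1.
  exact: fM.
have rs0 q : 0 <= \sum_(k < 4) riesz H d (u M q k n).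
  by apply: sumr_ge0 => k _; apply: riesz_ge0.
have -> : \sum_(h < H) f (iter (n + h) T x) * z (n + h)%N =
    \sum_(h < H) (f (iter (n + h) T x) - f (iter h T p)) * z (n + h)%N +
    M%:C * \sum_(h < H) u M p 0 n h.
  rewrite mulr_sumr -big_split/=; apply: eq_bigr => h _.
  rewrite /u expr0 mul1r !mulrA -rmorphM divff ?gt_eqF// rmorph1 mul1r.
  by rewrite mulrBl subrK.
apply: le_trans (normcD_le _ _) _; rewrite mulrDr lerD//.
  apply: le_trans (normc_sum_le _ _ _) _.
  apply: (@le_trans _ _ (\sum_(h < H) e)); last by rewrite sumr_const card_ord mulr_natl.
  apply: ler_sum => h _; rewrite normc_mul -[e]mulr1 ler_pM ?normc_ge0 ?normc_z_le1//.
  rewrite -opprB normc_opp fr// addnC iterD; exact: pB.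
rewrite normc_mul normc_real gtr0_norm// mulrCA ler_wpM2l ?(ltW M0)//.
have := normc_sum_le_riesz H d (u M p 0 n) d01 (u1 0%N p).
move=> /le_trans; apply; rewrite ler_wpM2l// lerD2l ler_wpM2l ?expR_ge0//.
(* The shadowing point [p] varies with [n]; summing the nonnegative products over all of [F] removes
   this dependence. This is the union bound. *)
rewrite (big_rem p)//= -[leLHS]addr0 lerD ?sumr_ge0//.
rewrite le_eqVlt; apply/orP; left; apply/eqP; apply: eq_bigr => k _; congr riesz.
by apply/funext => h; rewrite /u expr0 mul1r !mulrA.
Qed.

Lemma expRN_le_inv (a b : R) : 0 < a -> a <= b -> expR (- b) <= a^-1.
Proof.
move=> a0 ab; rewrite expRN lef_pV2 ?posrE ?expR_gt0// (le_trans ab)//.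
by apply: le_trans (expR_ge1Dx b); rewrite lerDr.
Qed.

Lemma orthogonal_eps (x : X) (e : R) : compact [set: X] ->
  topological_entropy T = 0%E -> continuous f -> 0 < e ->
  \forall N \near \oo,
    normc (\sum_(n < N) f (iter n T x) * z n) <= e * N%:R.
Proof.
move=> X_compact hT fc e0.
have [M M0 fM] := continuous_compact_normc_bounded X_compact _ fc.
have e8 : 0 < e / 8 by rewrite divr_gt0.
have [r r0 fr] := continuous_compact_uniform X_compact _ _ fc e8.
pose d := Num.min 1 (e / (16 * M)).
have d01 : 0 < d <= 1.
  by rewrite /d lt_min ltr01 divr_gt0 ?mulr_gt0//= ge_min lexx.
have Md : M * (2 * d) <= e / 8.
  have : d <= e / (16 * M) by rewrite /d ge_min lexx orbT.
  rewrite ler_pdivlMr ?mulr_gt0//; lra.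
(* [c] is the exponential gain of the Riesz products. Half of it absorbs the size of [F], and the
   other half tends to 0 as [H] grows. *)
pose c := d ^+ 2 / 8; have c0 : 0 < c.
  by rewrite divr_gt0// exprn_gt0//; case/andP: d01.
have c20 : 0 < c / 2 by rewrite divr_gt0.
have entropyH := entropy0_spanning T r (c / 2) hT r0 c20.
(* Four rotations, each of mean at most 2, give a factor 8 per point of [F]; the constant 64 leaves
   [e / 8] after paying it. *)
have a0 : 0 < 64 * M / e by rewrite divr_gt0// mulr_gt0.
have [H [H0 Hbig [F spF cardF]]] : exists H : nat, [/\ (0 < H)%N,
    64 * M / e <= c / 2 * H%:R & exists2 F : {fset X}, spanning T H r F &
    (#|` F|%:R : R) <= expR (c / 2 * H%:R)].
  near \oo => H; exists H; split.
  - by near: H; exact: nbhs_infty_gt.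
  - rewrite [leRHS]mulrC -ler_pdivrMr//.
    by near: H; exact: nbhs_infty_ger.
  - by near: H; exact: entropyH.
have ME : M * (expR (- (c * H%:R)) * ((#|` F|)%:R * 8)) <= e / 8.
  have Ehalf : expR (- (c * H%:R)) * (#|` F|)%:R <= e / (64 * M).
    apply: (@le_trans _ _ (expR (- (c * H%:R)) * expR (c / 2 * H%:R))).
      by rewrite ler_wpM2l// expR_ge0.
    rewrite -expRD (_ : _ + _ = - (c / 2 * H%:R)); last by field.
    by rewrite -[e / _]invf_div expRN_le_inv.
  rewrite mulrA.
  have -> : e / 8 = M * (e / (64 * M) * 8) by field; rewrite gt_eqF.
  by rewrite -mulrA ler_wpM2l ?(ltW M0)// mulrA ler_wpM2r.
have rieszN p k : \forall N \near \oo, \sum_(n < N) riesz H d (u M p k n) <= 2 * N%:R.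
  exact: riesz_mean.
have rieszNN p : \forall N \near \oo,
    \sum_(n < N) \sum_(k < 4) riesz H d (u M p k n) <= 8 * N%:R.
  have := near_sum_le _ (enum 'I_4) _ 2 (fun k : 'I_4 => rieszN p k).
  apply: filterS => N; rewrite size_enum_ord big_enum/= exchange_big/=.
  by rewrite (_ : 4 * 2 = 8 :> R)//; ring.
have rieszS := near_sum_le _ F _ 8 rieszNN.
near=> N.
have rieszSN : \sum_(n < N) \sum_(p <- F) \sum_(k < 4) riesz H d (u M p k n) <=
    (#|` F|)%:R * 8 * N%:R.
  by rewrite exchange_big/=; near: N; exact: rieszS.
have gM n : normc (f (iter n T x) * z n) <= M.
  by rewrite normc_mul -[M]mulr1 ler_pM ?normc_ge0 ?normc_z_le1.
have Hpos : 0 < H%:R :> R by rewrite ltr0n.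
(* [H] is fixed by now, so the boundary cost of the blocks is negligible for large [N]. *)
have MH : 2 * M * H%:R <= e / 8 * N%:R.
  rewrite [leRHS]mulrC -ler_pdivrMr//; near: N; exact: nbhs_infty_ger.
rewrite -(ler_pM2l Hpos).
apply: le_trans (normc_sum_blocks _ _ H N gM) _.
apply: (@le_trans _ _ (\sum_(n < N) (H%:R * (e / 8 + M * (2 * d + expR (- (c * H%:R)) *
      \sum_(p <- F) \sum_(k < 4) riesz H d (u M p k n)))) + H%:R * (e / 8 * N%:R))).
  apply: lerD; last by rewrite expr2 mulrA mulrC ler_wpM2l// ltW.
  by apply: ler_sum => n _; exact: (block_le _ _ _ _ _ _ _ _ M0 fM d01 fr spF).
rewrite -mulr_sumr -mulrDr ler_wpM2l// ?(ltW Hpos)//.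
have sum_cst (a : R) : \sum_(n < N) a = a * N%:R.
  by rewrite sumr_const card_ord mulr_natr.
rewrite big_split/= sum_cst -mulr_sumr big_split/= sum_cst -mulr_sumr.
have N0 : 0 <= N%:R :> R by [].
have : M * (expR (- (c * H%:R)) * \sum_(n < N) \sum_(p <- F) \sum_(k < 4) riesz H d (u M p k n))
   <= e / 8 * N%:R.
  apply: le_trans (ler_wpM2r N0 ME); rewrite -!mulrA ler_wpM2l ?(ltW M0)//.
  by rewrite ler_wpM2l ?expR_ge0// mulrA.
(* Shadowing, the term [2 * d], the Riesz products and the block boundaries contribute at most
   [e / 8 * N] each. *)
have := ler_wpM2r N0 Md.
have := mulr_ge0 (ltW e8) N0.
lra.
Unshelve. all: by end_near. Qed.

End Main.

Theorem theorem5p1 (R : realType) (z : nat -> cplx R)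
  (hz : forall n, (@unit_circle R `|` [set 0]) (z n))
  (z_Chowla : Chowla z)
  (X : metricType R) (X_compact : compact [set: X])
  (T : X -> X) (T_continuous : continuous T)
  (T_entropy0 : topological_entropy T = 0%E)
  (f : X -> cplx R) (f_continuous : continuous f) (x : X) :
  (\sum_(n < N) f (iter n T x) * z n) / N%:R @[N --> \oo] --> (0 : cplx R).
Proof.
apply/cvgrPdist_lt => -[e e']; rewrite ltcE /= => /andP[/eqP -> e0].
(* Halving turns the non-strict bound of [orthogonal_eps] into a strict one. *)
have e20 : 0 < e / 2 by rewrite divr_gt0.
near=> N.
have N0 : 0 < N%:R :> R by rewrite ltr0n; near: N; exact: nbhs_infty_gt.
rewrite sub0r normrN normrE_normc ltcR normc_mul.
rewrite -[N%:R](rmorph_nat (real_complex R)) -fmorphV normc_real gtr0_norm ?invr_gt0//.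
rewrite ltr_pdivrMr// (@le_lt_trans _ _ (e / 2 * N%:R))//; last first.
  by rewrite ltr_pM2r// ltr_pdivrMr// ltr_pMr// ltr1n.
by near: N; exact: orthogonal_eps.
Unshelve. all: by end_near. Qed.
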